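(* Let $q,\lambda,\lambda_1\in\mathbb C^*$, $\alpha,\alpha_1\in\mathbb C$, $\beta,\beta',\gamma,\gamma'\in\mathbb C^2$, $\mathbf h\in\mathcal T_\alpha$ and $\mathbf h_1\in\mathcal T_{\alpha_1}$. Isomorphisms below are of $\mathcal B(q)$-modules. (1) If $-2q\notin\mathbb N$, then $\Omega(\lambda,\alpha,\mathbf h)\cong\Omega(\lambda_1,\alpha_1,\mathbf h_1)$ if and only if $\lambda=\lambda_1$, $\alpha=\alpha_1$ and $\mathbf h=\mathbf h_1$. (2) If $-2q\in\mathbb N$ and $q\ne-1$, then $\Omega(\lambda,\alpha,\gamma,\mathbf h)\cong\Omega(\lambda_1,\alpha_1,\gamma',\mathbf h_1)$ if and only if $\lambda=\lambda_1$, $\alpha=\alpha_1$, $\gamma=\gamma'$ and $\mathbf h=\mathbf h_1$. (3) If $q=-1$, then $\Omega(\lambda,\alpha,\beta,\gamma,\mathbf h)\cong\Omega(\lambda_1,\alpha_1,\beta',\gamma',\mathbf h_1)$ if and only if $\lambda=\lambda_1$, $\alpha=\alpha_1$, $\beta=\beta'$, $\gamma=\gamma'$ and $\mathbf h=\mathbf h_1$.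
   Context: $\mathbb N=\{0,1,2,\dots\}$, $\mathbb C^*=\mathbb C\setminus\{0\}$. For $q\in\mathbb C^*$, the Takiff Block type Lie algebra $\mathcal B(q)$ is the complex Lie algebra with basis $\{L_{m,i},W_{m,i},C_1,C_2\mid (m,i)\in\mathbb Z\times\mathbb N\}$, with $C_1,C_2$ central and $[L_{m,i},L_{n,j}]=(n(i+q)-m(j+q))L_{m+n,i+j}+\frac{m^3-m}{12}\delta_{i+j,0}\delta_{m+n,0}C_1$, $[L_{m,i},W_{n,j}]=(n(i+q)-m(j+q))W_{m+n,i+j}+\frac{m^3-m}{12}\delta_{i+j,0}\delta_{m+n,0}C_2$, $[W_{m,i},W_{n,j}]=0$. For $k\in\mathbb N$, $n\in\mathbb Z$, $\alpha\in\mathbb C$ put $h_{n,k;\alpha}(t)=nt^k-n(n-1)\alpha\frac{t^k-\alpha^k}{t-\alpha}\in\mathbb C[t]$. $\mathcal T_\alpha$ is the set of all families $\mathbf h=\{h_m(t)\mid m\in\mathbb Z\}$ of polynomials of the form $h_m(t)=\sum_{i\ge0}\xi_ih_{m,i;\alpha}(t)$ with $\xi_i\in\mathbb C$ independent of $m$ and all but finitely many zero. For $\mathbf h\in\mathcal T_\alpha$ and $c\in\mathbb C$ put $\Theta_{\mathbf h,c}(t)=c\,\frac{h_1(-t)-h_1(\alpha)}{-t-\alpha}\in\mathbb C[t]$. For $\beta=(\beta_1,\beta_2)$, $\gamma=(\gamma_1,\gamma_2)$, the $\mathcal B(q)$-module $\Omega(\lambda,\alpha,\beta,\gamma,\mathbf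 h)$ is $\mathbb C[t,s]$ with $C_1,C_2$ acting by $0$ and, for $(m,i)\in\mathbb Z\times\mathbb N$, $L_{m,i}f(t,s)=\delta_{i,0}\lambda^m(s+qh_m(q^{-1}t))f(t,s-mq)-\delta_{i,0}m\lambda^mq(t-mq\alpha)\frac{\partial}{\partial t}f(t,s-mq)+\delta_{m,0}\delta_{i,-2q}\gamma_2f(t,s)+\delta_{i,1}\delta_{q,-1}\lambda^m\big(\beta_2+m\Theta_{\mathbf h,\beta_1}(t)+m\beta_1\frac{\partial}{\partial t}\big)f(t,s+m)$, $W_{m,i}f(t,s)=\delta_{i,0}\lambda^m(t-mq\alpha)f(t,s-mq)+\delta_{m,0}\delta_{i,-2q}\gamma_1f(t,s)+\delta_{i,1}\delta_{q,-1}\beta_1\lambda^mf(t,s+m)$. Shorthand: if $-2q\notin\mathbb N$, $\Omega(\lambda,\alpha,\mathbf h):=\Omega(\lambda,\alpha,0,0,\mathbf h)$; if $-2q\in\mathbb N$ and $q\ne-1$, $\Omega(\lambda,\alpha,\gamma,\mathbf h):=\Omega(\lambda,\alpha,0,\gamma,\mathbf h)$. *)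

(* Defs.v *)
From HB Require Import structures.
From mathcomp Require Import all_boot all_order all_algebra.
From mathcomp Require Import finmap.
From mathcomp Require Import ring.
From mathcomp.multinomials Require monalg.
From mathcomp.multinomials Require Import mpoly.

Set Implicit Arguments.
Unset Strict Implicit.
Unset Printing Implicit Defensive.

Import GRing.Theory Num.Theory.
Local Open Scope ring_scope.

Record nonzero (K : fieldType) := Nonzero {
  nzval :> K;
  nzvalP : nzval != 0
}.

Record lieAlgebra (K : fieldType) := LieAlgebra {
  lie_sort :> lmodType K;
  lie_bracket : lie_sort -> lie_sort -> lie_sort;
  lie_bracket_linearl : forall y, linear (fun x => lie_bracket x y);
  lie_bracket_linearr : forall x, linear (lie_bracket x);
  lie_bracket_alternating : forall x, lie_bracket x x = 0;
  lie_bracket_jacobi : forall x y z,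
    lie_bracket x (lie_bracket y z) + lie_bracket y (lie_bracket z x)
      + lie_bracket z (lie_bracket x y) = 0
}.

Record lieModule (K : fieldType) (g : lieAlgebra K) := LieModule {
  liemod_sort :> lmodType K;
  lie_act : g -> liemod_sort -> liemod_sort;
  lie_act_linearl : forall v, linear (fun x => lie_act x v);
  lie_act_linearr : forall x, linear (lie_act x);
  lie_act_bracket : forall x y v,
    lie_act (lie_bracket x y) v
      = lie_act x (lie_act y v) - lie_act y (lie_act x v)
}.

Definition liemod_iso (K : fieldType) (g : lieAlgebra K)
    (M N : lieModule g) : Prop :=
  exists2 f : {linear M -> N},
    bijective f & forall x v, f (lie_act x v) = lie_act x (f v).

Section FreeModule.
Import monalg.
Variables (K : fieldType) (B : choiceType).

Definition free_module : lmodType K := {malg K[B]}.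
Local Notation FB := free_module.

(* [evb b] is the basis vector of b, and [linext F] is the linear map sending
   each basis vector b to [F b]. *)
Definition evb (b : B) : FB := mkmalgU b 1.

Definition linext (V : lmodType K) (F : B -> V) (x : FB) : V :=
  \sum_(b <- msupp x) mcoeff b x *: F b.

Lemma linextEw (V : lmodType K) (F : B -> V) (x : FB) (d : {fset B}) :
  (msupp x `<=` d)%fset ->
  linext F x = \sum_(b <- d) mcoeff b x *: F b.
Proof.
move=> sub; rewrite /linext (big_fset_incl _ sub) // => b _.
by move/mcoeff_outdom ->; rewrite scale0r.
Qed.

Lemma linext_linear (V : lmodType K) (F : B -> V) : linear (linext F).
Proof.
move=> c x y.
pose d := (msupp x `|` msupp y)%fset.
rewrite !(@linextEw _ _ _ d) ?fsubsetUl ?fsubsetUr //; last first.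
  apply: (fsubset_trans (msuppD_le _ _)).
  by rewrite fsetSU // msuppZ_le.
rewrite scaler_sumr -big_split; apply: eq_bigr => b _ /=.
by rewrite mcoeffD mcoeffZ scalerDl scalerA.
Qed.

Lemma linext_evb (V : lmodType K) (F : B -> V) (b : B) :
  linext F (evb b) = F b.
Proof.
rewrite /linext /evb msuppU oner_eq0 big_seq_fset1.
by rewrite mcoeffUU scale1r.
Qed.

Lemma free_decomp (x : FB) :
  x = \sum_(b <- msupp x) mcoeff b x *: evb b.
Proof.
rewrite [LHS]monalgE; apply: eq_bigr => b _.
apply/malgP => k; rewrite mcoeffZ /evb !mcoeffU.
by rewrite mulrnAr mulr1.
Qed.

Lemma free_ind (P : FB -> Prop) :
  P 0 -> (forall c b x, P x -> P (c *: evb b + x)) -> forall x, P x.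
Proof.
move=> P0 PD x; rewrite [x]free_decomp; elim: (enum_fset _) => [|b s IH].
  by rewrite big_nil.
by rewrite big_cons; apply: PD.
Qed.

Lemma linext_linear_comp (U V : lmodType K) (F : B -> U -> V) (x : FB) :
  (forall b, linear (F b)) -> linear (fun u => linext (F ^~ u) x).
Proof.
move=> lF c u v; rewrite /linext scaler_sumr -big_split; apply: eq_bigr => b _ /=.
by rewrite lF scalerDr !scalerA mulrC.
Qed.

End FreeModule.

Inductive block_basis : Type :=
  | BL of int & nat | BW of int & nat | BC1 | BC2.

Definition block_basis_encode (b : block_basis) :
    (int * nat + int * nat) + bool :=
  match b with
  | BL m i => inl (inl (m, i))
  | BW m i => inl (inr (m, i))
  | BC1 => inr false
  | BC2 => inr true
  end.

Definition block_basis_decode (c : (int * nat + int * nat) + bool) :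
    block_basis :=
  match c with
  | inl (inl (m, i)) => BL m i
  | inl (inr (m, i)) => BW m i
  | inr false => BC1
  | inr true => BC2
  end.

Lemma block_basis_encodeK : cancel block_basis_encode block_basis_decode.
Proof. by case. Qed.

HB.instance Definition _ :=
  Choice.copy block_basis (can_type block_basis_encodeK).

Section BlockRelations.
Variables (K : fieldType) (q : K) (V : lmodType K) (e : block_basis -> V).

(* [L_(m,i), X_(n,j)] has coefficient [block_coef m i n j] on X_(m+n,i+j), for
   X = L or W, and [block_central m i n j] on C_1 or C_2 respectively. *)
Definition block_coef (m : int) (i : nat) (n : int) (j : nat) : K :=
  n%:~R * (i%:R + q) - m%:~R * (j%:R + q).

Definition block_central (m : int) (i : nat) (n : int) (j : nat) : K :=
  (m%:~R ^+ 3 - m%:~R) / 12%:R * ((i + j)%N == 0%N)%:R * (m + n == 0)%:R.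

Definition block_bracket_basis (a b : block_basis) : V :=
  match a, b with
  | BL m i, BL n j =>
      block_coef m i n j *: e (BL (m + n) (i + j))
        + block_central m i n j *: e BC1
  | BL m i, BW n j =>
      block_coef m i n j *: e (BW (m + n) (i + j))
        + block_central m i n j *: e BC2
  | BW m i, BL n j =>
      - (block_coef n j m i *: e (BW (n + m) (j + i))
           + block_central n j m i *: e BC2)
  | _, _ => 0
  end.

Lemma block_coefN m i n j : block_coef n j m i = - block_coef m i n j.
Proof. by rewrite /block_coef; ring. Qed.

Lemma block_centralN m i n j : block_central n j m i = - block_central m i n j.
Proof.
rewrite /block_central (addnC j) (addrC n).
case: (eqVneq (m + n) 0) => [/eqP|_]; last by rewrite !mulr0 oppr0.
by rewrite addr_eq0 => /eqP ->; rewrite rmorphN /=; ring.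
Qed.

Lemma block_bracket_basis_anti a b :
  block_bracket_basis a b + block_bracket_basis b a = 0.
Proof.
case: a b => [m i|m i||] [n j|n j||] //=; rewrite ?addr0 ?subrr ?addNr //.
rewrite (block_coefN m i n j) (block_centralN m i n j) (addrC n) (addnC j) !scaleNr -opprD.
by rewrite subrr.
Qed.

Lemma block_bracket_basis_alt a : block_bracket_basis a a = 0.
Proof.
case: a => [m i|m i||] //=.
have -> : block_coef m i m i = 0 by rewrite /block_coef; ring.
rewrite scale0r add0r /block_central.
case: (eqVneq m 0) => [->|m0].
  by rewrite expr0n subrr !mul0r scale0r.
suff -> : (m + m == 0) = false by rewrite mulr0 scale0r.
by apply/negbTE; rewrite -mulr2n mulrn_eq0.
Qed.

Section Jacobi.
Variable br : V -> V -> V.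
Hypothesis spanV : forall P : V -> Prop,
  P 0 -> (forall c b x, P x -> P (c *: e b + x)) -> forall x, P x.
Hypothesis br_linl : forall y, linear (fun x => br x y).
Hypothesis br_linr : forall x, linear (br x).
Hypothesis brE : forall a b, br (e a) (e b) = block_bracket_basis a b.

Let br_r x : {linear V -> V} := HB.pack (br x)
  (GRing.isLinear.Build K V V _ _ (br_linr x)).
Let br_l y : {linear V -> V} := HB.pack (fun x => br x y)
  (GRing.isLinear.Build K V V _ _ (br_linl y)).

Let brDr x y z : br x (y + z) = br x y + br x z.
Proof. exact: (linearD (br_r x)). Qed.
Let brNr x y : br x (- y) = - br x y.
Proof. exact: (linearN (br_r x)). Qed.
Let brZr c x y : br x (c *: y) = c *: br x y.
Proof. exact: (linearZZ (br_r x)). Qed.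
Let br0r x : br x 0 = 0.
Proof. exact: (linear0 (br_r x)). Qed.
Let brDl x y z : br (x + y) z = br x z + br y z.
Proof. exact: (linearD (br_l z)). Qed.
Let brZl c x y : br (c *: x) y = c *: br x y.
Proof. exact: (linearZZ (br_l y)). Qed.
Let br0l x : br 0 x = 0.
Proof. exact: (linear0 (br_l x)). Qed.

Let lin_eq0 (f : V -> V) :
  linear f -> (forall b, f (e b) = 0) -> forall x, f x = 0.
Proof.
move=> lf f0; pose g : {linear V -> V} :=
  HB.pack f (GRing.isLinear.Build K V V _ _ lf).
apply: spanV => [|c b x IH]; first exact: (linear0 g).
by rewrite lf f0 IH scaler0 addr0.
Qed.

Lemma bracket_anti x y : br x y + br y x = 0.
Proof.
move: x; apply: lin_eq0 => [c x x'|a].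
  by rewrite brDl brZl brDr brZr scalerDr addrACA.
move: y; apply: lin_eq0 => [c x x'|b].
  by rewrite brDl brZl brDr brZr scalerDr addrACA.
by rewrite !brE block_bracket_basis_anti.
Qed.

Lemma bracket_alternating x : br x x = 0.
Proof.
move: x; apply: spanV => [|c b x IH]; first by rewrite br0l.
rewrite brDl !brDr IH addr0 -addrA bracket_anti addr0.
by rewrite brZl brZr brE block_bracket_basis_alt !scaler0.
Qed.

Let central1 x : br x (e BC1) = 0.
Proof. by move: x; apply: lin_eq0 => // -[m i|m i||]; rewrite brE. Qed.

Let central2 x : br x (e BC2) = 0.
Proof. by move: x; apply: lin_eq0 => // -[m i|m i||]; rewrite brE. Qed.

Let coef_jacobi m i n j p k :
  block_coef n j p k * block_coef m i (n + p) (j + k)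
  + block_coef p k m i * block_coef n j (p + m) (k + i)
  + block_coef m i n j * block_coef p k (m + n) (i + j) = 0.
Proof. by rewrite /block_coef !natrD !rmorphD /=; ring. Qed.

Let central_jacobi m i n j p k :
  block_coef n j p k * block_central m i (n + p) (j + k)
  + block_coef p k m i * block_central n j (p + m) (k + i)
  + block_coef m i n j * block_central p k (m + n) (i + j) = 0.
Proof.
rewrite /block_central.
have -> : n + (p + m) = m + (n + p) by ring.
have -> : p + (m + n) = m + (n + p) by ring.
have -> : (j + (k + i) = i + (j + k))%N by ring.
have -> : (k + (i + j) = i + (j + k))%N by ring.
case: (eqVneq (m + (n + p)) 0) => [mnp|_]; last by rewrite !mulr0 !addr0.
case: (eqVneq (i + (j + k))%N 0%N) => [ijk|_];
  last by rewrite !(mulr0, mul0r) !addr0.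
have [-> [-> ->]] : i = 0%N /\ j = 0%N /\ k = 0%N.
  by move/eqP: ijk; rewrite !addn_eq0 => /and3P [/eqP -> /eqP -> /eqP ->].
have -> : m = - (n + p) by apply/eqP; rewrite -addr_eq0 mnp.
by rewrite /block_coef !(rmorphD, rmorphN) /=; ring.
Qed.

Let jac x y z := br x (br y z) + br y (br z x) + br z (br x y).

Let jac_cyc x y z : jac x y z = jac y z x.
Proof. by rewrite /jac -addrA [LHS]addrC. Qed.

Let jac_linear y z : linear (fun x => jac x y z).
Proof.
exact: (linearP ((br_l (br y z) \+ (br_r y \o br_r z)) \+ (br_r z \o br_l y))).
Qed.

Let sum3_eq0 (a1 a2 a3 b1 b2 b3 : K) (u w : V) :
  a1 + a2 + a3 = 0 -> b1 + b2 + b3 = 0 ->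
  (a1 *: u + b1 *: w) + (a2 *: u + b2 *: w) + (a3 *: u + b3 *: w) = 0.
Proof.
move=> a0 b0; rewrite (addrACA (a1 *: u)) -!scalerDl addrACA -!scalerDl.
by rewrite a0 b0 !scale0r addr0.
Qed.

Let jacLL m i n j c : jac (e (BL m i)) (e (BL n j)) (e c) = 0.
Proof.
rewrite /jac; case: c => [p k|p k||]; rewrite !brE /=;
  last by rewrite !br0r brDr !brZr brE central1 !scaler0 !addr0.
- rewrite !(brDr, brZr, central1, scaler0, addr0) !brE /= !scalerDr !scalerA.
  have -> : e (BL (n + (p + m)) (j + (k + i))) = e (BL (m + (n + p)) (i + (j + k))).
    by congr (e (BL _ _)); ring.
  have -> : e (BL (p + (m + n)) (k + (i + j))) = e (BL (m + (n + p)) (i + (j + k))).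
    by congr (e (BL _ _)); ring.
  exact: sum3_eq0.
- rewrite !(brDr, brZr, brNr, central1, central2, scaler0, addr0) !brE /=.
  rewrite !(scalerN, scalerDr, scalerA) !opprD -!scaleNr.
  have -> : e (BW (n + (m + p)) (j + (i + k))) = e (BW (m + (n + p)) (i + (j + k))).
    by congr (e (BW _ _)); ring.
  have -> : e (BW (m + n + p) (i + j + k)) = e (BW (m + (n + p)) (i + (j + k))).
    by congr (e (BW _ _)); ring.
  apply: sum3_eq0.
    rewrite -[RHS](coef_jacobi m i n j p k) (block_coefN m i p k).
    by rewrite (block_coefN (m + n) _ p) (addrC p) (addnC k); ring.
  rewrite -[RHS](central_jacobi m i n j p k) (block_coefN m i p k).
  by rewrite (block_centralN (m + n) _ p) (addrC p) (addnC k); ring.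
by rewrite !br0r brDr !brZr brE central1 !scaler0 !addr0.
Qed.

Let jacLWW m i n j p k : jac (e (BL m i)) (e (BW n j)) (e (BW p k)) = 0.
Proof.
rewrite /jac !brE /= br0r !(brDr, brZr, brNr, central2) !brE /=.
by rewrite !(scaler0, oppr0, addr0).
Qed.

Let jac_central1 x y : jac x y (e BC1) = 0.
Proof.
have c1 z : br (e BC1) z = 0.
  by rewrite -[LHS]addr0 -(central1 z) bracket_anti.
by rewrite /jac central1 !c1 !br0r !addr0.
Qed.

Let jac_central2 x y : jac x y (e BC2) = 0.
Proof.
have c2 z : br (e BC2) z = 0.
  by rewrite -[LHS]addr0 -(central2 z) bracket_anti.
by rewrite /jac central2 !c2 !br0r !addr0.
Qed.

Let jac_basis a b c : jac (e a) (e b) (e c) = 0.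
Proof.
have LL m i n j x : jac (e x) (e (BL m i)) (e (BL n j)) = 0.
  by rewrite jac_cyc jacLL.
have LxL m i n j x : jac (e (BL n j)) (e x) (e (BL m i)) = 0.
  by rewrite 2!jac_cyc jacLL.
have c1 x y : jac (e BC1) x y = 0 by rewrite jac_cyc jac_central1.
have c2 x y : jac (e BC2) x y = 0 by rewrite jac_cyc jac_central2.
have d1 x y : jac x (e BC1) y = 0 by rewrite jac_cyc c1.
have d2 x y : jac x (e BC2) y = 0 by rewrite jac_cyc c2.
case: a b c => [m i|m i||] [n j|n j||] [p k|p k||];
  rewrite ?jac_central1 ?jac_central2 ?c1 ?c2 ?d1 ?d2 ?jacLL ?LL ?LxL ?jacLWW //.
- by rewrite jac_cyc jacLWW.
- by rewrite 2!jac_cyc jacLWW.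
by rewrite /jac !brE /= !br0r !addr0.
Qed.

Lemma bracket_jacobi x y z :
  br x (br y z) + br y (br z x) + br z (br x y) = 0.
Proof.
rewrite -/(jac x y z).
move: x; apply: lin_eq0 => // a; rewrite jac_cyc.
move: y; apply: lin_eq0 => // b; rewrite jac_cyc.
by move: z; apply: lin_eq0 => // c; apply: jac_basis.
Qed.
End Jacobi.
End BlockRelations.

Section TakiffBlock.
Variables (K : fieldType) (q : K).

(* The bilinear extension of the bracket on basis vectors. *)
Definition block_bracket (x y : free_module K block_basis) :
    free_module K block_basis :=
  linext (fun a => linext (block_bracket_basis q (@evb K block_basis) a) y) x.

Lemma block_bracket_linearl y : linear (fun x => block_bracket x y).
Proof. exact: linext_linear. Qed.

Lemma block_bracket_linearr x : linear (block_bracket x).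
Proof. by apply: linext_linear_comp => b; apply: linext_linear. Qed.

Lemma block_bracket_evb a b :
  block_bracket (evb K a) (evb K b) = block_bracket_basis q (@evb K _) a b.
Proof. by rewrite [LHS](linext_evb _ a) linext_evb. Qed.

Definition TakiffBlock : lieAlgebra K :=
  LieAlgebra block_bracket_linearl block_bracket_linearr
    (bracket_alternating (@free_ind K block_basis) block_bracket_linearl
       block_bracket_linearr block_bracket_evb)
    (bracket_jacobi (@free_ind K block_basis) block_bracket_linearl
       block_bracket_linearr block_bracket_evb).
End TakiffBlock.

Section Families.
Variable K : fieldType.

(* Both divisions below are exact: the divisor is 'X - c or -'X - c, with a
   dividend vanishing at its root. *)
Definition hpoly (alpha : K) (n : int) (k : nat) : {poly K} :=
  n%:~R *: 'X^k
    - (n%:~R * (n%:~R - 1) * alpha)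
        *: (('X^k - (alpha ^+ k)%:P) %/ ('X - alpha%:P)).

(* An element of T_alpha; the finitely many nonzero coefficients are listed
   in the sequence [xi]. *)
Record Tfamily (alpha : K) := TFamily {
  tfam :> int -> {poly K};
  tfamP : exists xi : seq K, forall m,
    tfam m = \sum_(i < size xi) xi`_i *: hpoly alpha m i
}.

Definition Theta (alpha : K) (h : Tfamily alpha) (c : K) : {poly K} :=
  c *: (((h 1 \Po (- 'X)) - (h 1).[alpha]%:P) %/ (- 'X - alpha%:P)).

Lemma exact_divp_Xsub (p : {poly K}) (a : K) :
  p = p.[a]%:P + ((p - p.[a]%:P) %/ ('X - a%:P)) * ('X - a%:P).
Proof.
rewrite divpK ?subrKC // dvdp_XsubCl /root hornerD hornerN hornerC.
by rewrite subrr.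
Qed.

Lemma tfam_factor (alpha : K) (h : Tfamily alpha) :
  exists p g : {poly K}, exists2 c : K,
    p = c%:P + g * ('X - alpha%:P) &
    forall m : int,
      h m = m%:~R *: p - (m%:~R * (m%:~R - 1) * alpha) *: g.
Proof.
have [xi hE] := tfamP h.
exists (\sum_(i < size xi) xi`_i *: 'X^i).
exists (\sum_(i < size xi)
  xi`_i *: (('X^i - (alpha ^+ i)%:P) %/ ('X - alpha%:P))).
exists (\sum_(i < size xi) xi`_i * alpha ^+ i) => [|m].
  rewrite mulr_suml rmorph_sum -big_split; apply: eq_bigr => i _ /=.
  have := exact_divp_Xsub 'X^i alpha; rewrite hornerXn => {1}->.
  by rewrite scalerDr -scalerAl polyCM mul_polyC.
rewrite hE !scaler_sumr -sumrB; apply: eq_bigr => i _.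
by rewrite /hpoly scalerBr !scalerA ![xi`_i * _]mulrC.
Qed.

Lemma Theta_factor (alpha : K) (h : Tfamily alpha) (p g : {poly K}) (c b : K) :
  p = c%:P + g * ('X - alpha%:P) ->
  (forall m : int, h m = m%:~R *: p - (m%:~R * (m%:~R - 1) * alpha) *: g) ->
  Theta h b = b *: (g \Po (- 'X)).
Proof.
move=> pE hE; rewrite /Theta hE subrr mulr0 mul0r scale0r subr0 scale1r.
have -> : p.[alpha] = c.
  by rewrite pE !hornerE subrr mulr0 addr0.
rewrite {1}pE comp_polyD comp_polyC comp_polyM comp_polyB comp_polyX.
rewrite comp_polyC addrC addKr mulpK // -opprD oppr_eq0.
by rewrite -(opprK alpha%:P) -polyCN polyXsubC_eq0.
Qed.
End Families.

(* [{mpoly K[2]}] is K[t, s], with t = 'X_0 and s = 'X_1. *)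
Section Omega.
Variable K : fieldType.
Local Notation Kts := {mpoly K[2]}.

Definition var_t : Kts := 'X_(ord0 : 'I_2).
Definition var_s : Kts := 'X_(ord_max : 'I_2).

(* f(t, s + c) *)
Definition shift_s (c : K) (f : Kts) : Kts :=
  f \mPo [tuple var_t; var_s + c%:MP].

Definition deriv_t (f : Kts) : Kts := f^`M(ord0).

(* p(u), for a polynomial p in one variable *)
Definition poly_at (p : {poly K}) (u : Kts) : Kts :=
  (map_poly (@mpolyC 2 K) p).[u].

Section Action.
Variables (q lambda alpha : K) (beta gamma : K * K).
Variable h : Tfamily alpha.

(* The action of one basis vector of the Lie algebra on f(t, s); beta and gamma
   are the pairs (beta_1, beta_2) and (gamma_1, gamma_2). *)
Definition omega_basis (b : block_basis) (f : Kts) : Kts :=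
  match b with
  | BL m i =>
      ((i == 0%N)%:R * lambda ^ m)
          *: ((var_s + q *: poly_at (h m) (q^-1 *: var_t)) * shift_s (- (m%:~R * q)) f)
      - ((i == 0%N)%:R * m%:~R * lambda ^ m * q)
          *: ((var_t - (m%:~R * q * alpha)%:MP)
                * deriv_t (shift_s (- (m%:~R * q)) f))
      + ((m == 0)%:R * (i%:R == - 2 * q)%:R * gamma.2) *: f
      + ((i == 1%N)%:R * (q == -1)%:R * lambda ^ m)
          *: ((beta.2%:MP + m%:~R *: poly_at (Theta h beta.1) var_t)
                * shift_s m%:~R f
              + (m%:~R * beta.1) *: deriv_t (shift_s m%:~R f))
  | BW m i =>
      ((i == 0%N)%:R * lambda ^ m)
          *: ((var_t - (m%:~R * q * alpha)%:MP) * shift_s (- (m%:~R * q)) f)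
      + ((m == 0)%:R * (i%:R == - 2 * q)%:R * gamma.1) *: f
      + ((i == 1%N)%:R * (q == -1)%:R * beta.1 * lambda ^ m)
          *: shift_s m%:~R f
  | BC1 | BC2 => 0
  end.
End Action.

Lemma shift_s0 c : shift_s c 0 = 0. Proof. exact: comp_mpoly0. Qed.
Lemma shift_sD c f g : shift_s c (f + g) = shift_s c f + shift_s c g.
Proof. exact: comp_mpolyD. Qed.
Lemma shift_sN c f : shift_s c (- f) = - shift_s c f.
Proof. exact: comp_mpolyN. Qed.
Lemma shift_sZ c a f : shift_s c (a *: f) = a *: shift_s c f.
Proof. exact: comp_mpolyZ. Qed.
Lemma shift_sC c a : shift_s c a%:MP = a%:MP.
Proof. exact: comp_mpolyC. Qed.
Lemma shift_sM c f g : shift_s c (f * g) = shift_s c f * shift_s c g.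
Proof. exact: rmorphM. Qed.
Lemma shift_sXn c f k : shift_s c (f ^+ k) = shift_s c f ^+ k.
Proof. exact: rmorphXn. Qed.
Lemma shift_s_nat c k : shift_s c k%:R = k%:R.
Proof. exact: rmorph_nat. Qed.
Lemma shift_s_t c : shift_s c var_t = var_t.
Proof. by rewrite /shift_s comp_mpolyXU. Qed.
Lemma shift_s_s c : shift_s c var_s = var_s + c%:MP.
Proof. by rewrite /shift_s comp_mpolyXU. Qed.

Lemma deriv_t0 : deriv_t 0 = 0. Proof. exact: mderiv0. Qed.
Lemma deriv_tD f g : deriv_t (f + g) = deriv_t f + deriv_t g.
Proof. exact: mderivD. Qed.
Lemma deriv_tN f : deriv_t (- f) = - deriv_t f.
Proof. exact: mderivN. Qed.
Lemma deriv_tZ a f : deriv_t (a *: f) = a *: deriv_t f.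
Proof. exact: mderivZ. Qed.
Lemma deriv_tC a : deriv_t a%:MP = 0.
Proof. exact: mderivC. Qed.
Lemma deriv_tM f g : deriv_t (f * g) = deriv_t f * g + f * deriv_t g.
Proof. exact: mderivM. Qed.
Lemma deriv_t_t : deriv_t var_t = 1.
Proof.
rewrite /deriv_t /var_t mderivX mnm1E eqxx scale1r -mpolyX0; congr 'X_[_].
by apply/mnmP => j; rewrite mnmBE mnm0E subnn.
Qed.
Lemma deriv_t_s : deriv_t var_s = 0.
Proof. by rewrite /deriv_t /var_s mderivX mnm1E /= scale0r. Qed.

Lemma monomial_ts (m : 'X_{1..2}) :
  'X_[m] = var_t ^+ m ord0 * var_s ^+ m ord_max :> Kts.
Proof.
rewrite mpolyXE_id !big_ord_recl big_ord0 mulr1.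
by congr (_ * 'X__ ^+ m _); apply: val_inj.
Qed.

Lemma poly_at0 u : poly_at 0 u = 0.
Proof. by rewrite /poly_at rmorph0 horner0. Qed.
Lemma poly_atD p p' u : poly_at (p + p') u = poly_at p u + poly_at p' u.
Proof. by rewrite /poly_at rmorphD hornerD. Qed.
Lemma poly_atM p p' u : poly_at (p * p') u = poly_at p u * poly_at p' u.
Proof. by rewrite /poly_at rmorphM hornerM. Qed.
Lemma poly_atC a u : poly_at a%:P u = a%:MP.
Proof. by rewrite /poly_at map_polyC hornerC. Qed.
Lemma poly_atX u : poly_at 'X u = u.
Proof. by rewrite /poly_at map_polyX hornerX. Qed.
Lemma poly_atN p u : poly_at (- p) u = - poly_at p u.
Proof. by rewrite /poly_at rmorphN hornerN. Qed.
Lemma poly_atZ a p u : poly_at (a *: p) u = a *: poly_at p u.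
Proof. by rewrite -mul_polyC poly_atM poly_atC mul_mpolyC. Qed.

Lemma poly_at_comp p r u : poly_at (p \Po r) u = poly_at p (poly_at r u).
Proof.
elim/poly_ind: p => [|p d IH]; first by rewrite comp_poly0 !poly_at0.
by rewrite comp_polyD comp_polyM comp_polyX comp_polyC
  !(poly_atD, poly_atM, poly_atC, poly_atX) IH.
Qed.

Local Opaque shift_s deriv_t var_t var_s poly_at.

Lemma shift_s_poly_at c p u :
  shift_s c u = u -> shift_s c (poly_at p u) = poly_at p u.
Proof.
move=> uE; elim/poly_ind: p => [|p d IH]; first by rewrite poly_at0 shift_s0.
by rewrite !(poly_atD, poly_atM, poly_atC, poly_atX) shift_sD shift_sM IH uE
  shift_sC.
Qed.

Lemma deriv_t_poly_at p u :
  deriv_t (poly_at p u) = poly_at p^`() u * deriv_t u.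
Proof.
elim/poly_ind: p => [|p d IH]; first by rewrite deriv0 poly_at0 deriv_t0 mul0r.
rewrite derivD derivC derivM derivX mulr1 addr0.
rewrite !(poly_atD, poly_atM, poly_atC, poly_atX) deriv_tD deriv_tM IH deriv_tC.
ring.
Qed.

Lemma shift_s_shift c d f : shift_s c (shift_s d f) = shift_s (c + d) f.
Proof.
elim/mpolyind: f => [|a m f _ _ IH]; first by rewrite !shift_s0.
rewrite !shift_sD !shift_sZ IH monomial_ts !shift_sM !shift_sXn !shift_s_t.
by rewrite !shift_s_s shift_sD shift_sC shift_s_s rmorphD addrA.
Qed.

Lemma deriv_t_shift c f : deriv_t (shift_s c f) = shift_s c (deriv_t f).
Proof.
have derX (a : Kts) k : deriv_t (a ^+ k) = k%:R * a ^+ k.-1 * deriv_t a.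
  elim: k => [|k IH]; first by rewrite expr0 !mul0r -mpolyC1 deriv_tC.
  rewrite exprS deriv_tM IH.
  by case: k {IH} => [|k]; rewrite /= ?expr0 ?exprS -?natr1; ring.
elim/mpolyind: f => [|a m f _ _ IH]; first by rewrite !(shift_s0, deriv_t0).
rewrite !(shift_sD, shift_sZ, deriv_tD, deriv_tZ) IH monomial_ts.
rewrite !(shift_sM, shift_sXn, deriv_tM, derX, shift_s_t, shift_s_s, deriv_t_t).
rewrite deriv_tD deriv_tC deriv_t_s !(addr0, mulr0, mulr1).
by rewrite !(shift_sM, shift_sXn, shift_s_nat, shift_s_t, shift_s_s).
Qed.

End Omega.

(* The module relations, over any commutative algebra with operators behaving
   like multiplications, shifts in s and the derivation in t. *)
Section OmegaRelations.
Variables (K : fieldType) (A : comAlgType K) (C : {rmorphism K -> A}).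
Variables (vt vs : A) (S : K -> A -> A) (D : A -> A) (P : {poly K} -> A -> A).
Hypothesis scE : forall c x, c *: x = C c * x.
Hypothesis SD : forall c x y, S c (x + y) = S c x + S c y.
Hypothesis SM : forall c x y, S c (x * y) = S c x * S c y.
Hypothesis SC : forall c a, S c (C a) = C a.
Hypothesis St : forall c, S c vt = vt.
Hypothesis Ss : forall c, S c vs = vs + C c.
Hypothesis SS : forall c d x, S c (S d x) = S (c + d) x.
Hypothesis DD : forall x y, D (x + y) = D x + D y.
Hypothesis DM : forall x y, D (x * y) = D x * y + x * D y.
Hypothesis DC : forall a, D (C a) = 0.
Hypothesis Dt : D vt = 1.
Hypothesis Ds : D vs = 0.
Hypothesis DS : forall c x, D (S c x) = S c (D x).
Hypothesis PD : forall p p' u, P (p + p') u = P p u + P p' u.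
Hypothesis PM : forall p p' u, P (p * p') u = P p u * P p' u.
Hypothesis PC : forall a u, P a%:P u = C a.
Hypothesis PX : forall u, P 'X u = u.
Hypothesis Pcomp : forall p r u, P (p \Po r) u = P p (P r u).
Hypothesis SP : forall c p u, S c u = u -> S c (P p u) = P p u.
Hypothesis DP : forall p u, D (P p u) = P p^`() u * D u.

Variables (q lambda alpha : K) (beta gamma : K * K) (h : Tfamily alpha).
Hypotheses (q0 : q != 0) (lambda0 : lambda != 0).

Let act (b : block_basis) (f : A) : A :=
  match b with
  | BL m i =>
      ((i == 0%N)%:R * lambda ^ m)
          *: ((vs + q *: P (h m) (q^-1 *: vt)) * S (- (m%:~R * q)) f)
      - ((i == 0%N)%:R * m%:~R * lambda ^ m * q)
          *: ((vt - C (m%:~R * q * alpha))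
                * D (S (- (m%:~R * q)) f))
      + ((m == 0)%:R * (i%:R == - 2 * q)%:R * gamma.2) *: f
      + ((i == 1%N)%:R * (q == -1)%:R * lambda ^ m)
          *: ((C beta.2 + m%:~R *: P (Theta h beta.1) vt)
                * S m%:~R f
              + (m%:~R * beta.1) *: D (S m%:~R f))
  | BW m i =>
      ((i == 0%N)%:R * lambda ^ m)
          *: ((vt - C (m%:~R * q * alpha)) * S (- (m%:~R * q)) f)
      + ((m == 0)%:R * (i%:R == - 2 * q)%:R * gamma.1) *: f
      + ((i == 1%N)%:R * (q == -1)%:R * beta.1 * lambda ^ m)
          *: S m%:~R f
  | BC1 | BC2 => 0
  end.

Let u := q^-1 *: vt.
Let H (m : int) : A := P (h m) u.
Let H' (m : int) : A := P (h m)^`() u.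
Let Th : A := P (Theta h beta.1) vt.
Let Th' : A := P (Theta h beta.1)^`() vt.

Let T0 (m : int) (f : A) : A :=
  C (lambda ^ m) * ((vs + C q * H m) * S (- (m%:~R * q)) f
    - C (m%:~R * q) * (vt - C (m%:~R * q * alpha)) * D (S (- (m%:~R * q)) f)).
Let T1 (m : int) (f : A) : A :=
  C (lambda ^ m) * ((C beta.2 + m%:~R * Th) * S m%:~R f
    + C (m%:~R * beta.1) * D (S m%:~R f)).
Let U0 (m : int) (f : A) : A :=
  C (lambda ^ m) * (vt - C (m%:~R * q * alpha)) * S (- (m%:~R * q)) f.
Let U1 (m : int) (f : A) : A := C (lambda ^ m) * C beta.1 * S m%:~R f.

Let dn (i j : nat) : K := (i == j)%:R.
Let dq : K := (q == -1)%:R.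
Let dg (m : int) (i : nat) : K := (m == 0)%:R * (i%:R == - 2 * q)%:R.

Let actLE m i f : act (BL m i) f
  = C (dn i 0) * T0 m f + C (dg m i * gamma.2) * f + C (dn i 1 * dq) * T1 m f.
Proof.
rewrite /act -/u -/Th -/(H m) /T0 /T1 -/(dn i 0) -/(dn i 1) -/dq -/(dg m i) !scE.
move: (dn i 0) (dn i 1) dq (dg m i) (lambda ^ m) => d0 d1 d2 g l.
ring.
Qed.

Let actWE m i f : act (BW m i) f
  = C (dn i 0) * U0 m f + C (dg m i * gamma.1) * f + C (dn i 1 * dq) * U1 m f.
Proof.
rewrite /act /U0 /U1 -/(dn i 0) -/(dn i 1) -/dq -/(dg m i) !scE.
move: (dn i 0) (dn i 1) dq (dg m i) (lambda ^ m) => d0 d1 d2 g l.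
ring.
Qed.

Let Hs_spec : exists p g p' g' : A, exists c : K, [/\
  forall m, H m = m%:~R * p - m%:~R * (m%:~R - 1) * C alpha * g,
  forall m, H' m = m%:~R * p' - m%:~R * (m%:~R - 1) * C alpha * g',
  p = C c + g * (u - C alpha),
  p' = g + g' * (u - C alpha) &
  q = -1 -> Th = C beta.1 * g /\ Th' = - C beta.1 * g'].
Proof.
have [p [g [c pE hE]]] := tfam_factor h.
have PZ a r v : P (a *: r) v = C a * P r v by rewrite -mul_polyC PM PC.
have PN r v : P (- r) v = - P r v by rewrite -scaleN1r PZ rmorphN1 mulN1r.
have dE : p^`() = g^`() * ('X - alpha%:P) + g.
  by rewrite pE derivD derivC add0r derivM derivXsubC mulr1.
exists (P p u), (P g u), (P p^`() u), (P g^`() u), c; split=> [m|m|||q1].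
- by rewrite /H hE PD PN !PZ !rmorphM rmorphB rmorph1 !rmorph_int.
- rewrite /H' hE derivB !derivZ PD PN !PZ !rmorphM rmorphB rmorph1.
  by rewrite !rmorph_int.
- by rewrite {1}pE PD PM PD PN !PC PX.
- by rewrite dE !(PD, PM, PN, PC, PX) addrC.
have uE : u = P (- 'X) vt by rewrite PN PX /u q1 invrN1 scaleN1r.
have ThE := Theta_factor beta.1 pE hE.
rewrite /Th /Th' ThE derivZ deriv_comp !PZ PM !Pcomp -uE derivN derivX PN.
have -> : P 1 vt = 1 by rewrite -polyC1 PC rmorph1.
by split; ring.
Qed.

Let Su c : S c u = u.
Proof. by rewrite /u scE SM SC St. Qed.
Let SH c m : S c (H m) = H m. Proof. exact/SP/Su. Qed.
Let SH' c m : S c (H' m) = H' m. Proof. exact/SP/Su. Qed.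
Let STh' c : S c Th' = Th'. Proof. exact/SP/St. Qed.
Let S0 c : S c 0 = 0. Proof. by rewrite -(rmorph0 C) SC. Qed.
Let S1 c : S c 1 = 1. Proof. by rewrite -(rmorph1 C) SC. Qed.
Let STh c : S c Th = Th. Proof. exact/SP/St. Qed.
Let DH m : D (H m) = C q^-1 * H' m.
Proof.
have Du : D u = C q^-1 by rewrite /u scE DM DC Dt mul0r add0r mulr1.
by rewrite DP Du mulrC.
Qed.
Let DqH m : D (C q * H m) = H' m.
Proof.
by rewrite DM DC DH mul0r add0r mulrA -rmorphM divff // rmorph1 mul1r.
Qed.
Let DTh : D Th = Th'. Proof. by rewrite DP Dt mulr1. Qed.
Let Dnat (m : int) : D m%:~R = 0.
Proof. by rewrite -(rmorph_int C) DC. Qed.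
Let Snat c (m : int) : S c m%:~R = m%:~R.
Proof. by rewrite -(rmorph_int C) SC. Qed.
Let SN c x : S c (- x) = - S c x.
Proof. by rewrite -mulN1r SM -(rmorphN1 C) SC rmorphN1 mulN1r. Qed.
Let DN x : D (- x) = - D x.
Proof. by rewrite -mulN1r -(rmorphN1 C) DM DC rmorphN1; ring. Qed.
Let vtE : vt = C q * u.
Proof. by rewrite /u scE mulrA -rmorphM divff // rmorph1 mul1r. Qed.

Let simp := (DqH, SD, SM, SC, St, Ss, SH, STh, SH', STh', S0, S1, Snat, SN, DD, DM, DC, Dt, Ds, DS,
  DTh, Dnat, DN).

Let SSq m n x : S (- (m%:~R * q)) (S (- (n%:~R * q)) x)
  = S (- ((m + n)%:~R * q)) x.
Proof. by rewrite SS rmorphD -opprD -mulrDl. Qed.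

Let lamD (m n : int) : lambda ^ (m + n) = lambda ^ m * lambda ^ n.
Proof. by rewrite expfzDr. Qed.

Let T00 m n f : T0 m (T0 n f) - T0 n (T0 m f)
  = C (n%:~R * q - m%:~R * q) * T0 (m + n) f.
Proof.
have [p [g [p' [g' [c [HE HE' pE pE' _]]]]]] := Hs_spec.
rewrite /T0 !simp !SSq (addrC n m) lamD.
move: (S _ f) (S _ (D f)) (S _ (D (D f))) => F F1 F2.
rewrite !HE !HE' vtE pE pE' !intrD.
ring.
Qed.

Let T01 m n f : q = -1 ->
  T0 m (T1 n f) - T1 n (T0 m f) = - n%:~R * T1 (m + n) f.
Proof.
move=> q1; have [p [g [p' [g' [c [HE HE' pE pE' /(_ q1) [ThE Th'E]]]]]]] := Hs_spec.
have SSm x y z : S (- (x%:~R * q)) (S y%:~R z) = S (x + y)%:~R z.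
  by rewrite SS q1 mulrN1 opprK rmorphD.
have SSm' x y z : S y%:~R (S (- (x%:~R * q)) z) = S (x + y)%:~R z.
  by rewrite SS q1 mulrN1 opprK rmorphD addrC.
rewrite /T0 /T1 !simp !SSm !SSm' lamD.
move: (S _ f) (S _ (D f)) (S _ (D (D f))) => F F1 F2.
rewrite !HE !HE' ThE Th'E vtE pE pE' q1 !intrD.
ring.
Qed.

Let T11 m n f : T1 m (T1 n f) - T1 n (T1 m f) = 0.
Proof.
rewrite /T1 !simp !SS (addrC n%:~R).
move: (S _ f) (S _ (D f)) (S _ (D (D f))) => F F1 F2.
ring.
Qed.

Let TU00 m n f : T0 m (U0 n f) - U0 n (T0 m f)
  = C (n%:~R * q - m%:~R * q) * U0 (m + n) f.
Proof.
rewrite /T0 /U0 !simp !SSq (addrC n m) lamD.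
move: (S _ f) (S _ (D f)) => F F1.
rewrite !intrD; ring.
Qed.

Let TU01 m n f : q = -1 ->
  T0 m (U1 n f) - U1 n (T0 m f) = - n%:~R * U1 (m + n) f.
Proof.
move=> q1.
have SSm x y z : S (- (x%:~R * q)) (S y%:~R z) = S (x + y)%:~R z.
  by rewrite SS q1 mulrN1 opprK rmorphD.
have SSm' x y z : S y%:~R (S (- (x%:~R * q)) z) = S (x + y)%:~R z.
  by rewrite SS q1 mulrN1 opprK rmorphD addrC.
rewrite /T0 /U1 !simp !SSm !SSm' lamD.
move: (S _ f) (S _ (D f)) => F F1.
rewrite q1; ring.
Qed.

Let TU10 m n f : q = -1 ->
  T1 m (U0 n f) - U0 n (T1 m f) = m%:~R * U1 (m + n) f.
Proof.
move=> q1.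
have SSm x y z : S (- (x%:~R * q)) (S y%:~R z) = S (y + x)%:~R z.
  by rewrite SS q1 mulrN1 opprK rmorphD addrC.
have SSm' x y z : S y%:~R (S (- (x%:~R * q)) z) = S (y + x)%:~R z.
  by rewrite SS q1 mulrN1 opprK rmorphD.
rewrite /T1 /U0 /U1 !simp !SSm !SSm' lamD.
move: (S _ f) (S _ (D f)) => F F1.
rewrite q1; ring.
Qed.

Let TU11 m n f : T1 m (U1 n f) - U1 n (T1 m f) = 0.
Proof.
rewrite /T1 /U1 !simp !SS (addrC n%:~R).
move: (S _ f) (S _ (D f)) => F F1.
ring.
Qed.

Let U00 m n f : U0 m (U0 n f) = U0 n (U0 m f).
Proof. by rewrite /U0 !simp !SSq (addrC n m); ring. Qed.

Let U01 m n f : U0 m (U1 n f) = U1 n (U0 m f).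
Proof. by rewrite /U0 /U1 !simp !SS (addrC n%:~R); ring. Qed.

Let U11 m n f : U1 m (U1 n f) = U1 n (U1 m f).
Proof. by rewrite /U1 !simp !SS (addrC n%:~R); ring. Qed.

Let lin (T : A -> A) := forall a x y, T (C a * x + y) = C a * T x + T y.

Let T0_lin m : lin (T0 m).
Proof. by move=> a x y; rewrite /T0 !simp; ring. Qed.
Let T1_lin m : lin (T1 m).
Proof. by move=> a x y; rewrite /T1 !simp; ring. Qed.
Let U0_lin m : lin (U0 m).
Proof. by move=> a x y; rewrite /U0 !simp; ring. Qed.
Let U1_lin m : lin (U1 m).
Proof. by move=> a x y; rewrite /U1 !simp; ring. Qed.

Let lin3 (T : A -> A) a b c x y z : lin T ->
  T (C a * x + C b * y + C c * z) = C a * T x + C b * T y + C c * T z.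
Proof.
move=> lT; have T00' : T 0 = 0.
  have E := lT 1 0 0; rewrite rmorph1 !mul1r addr0 in E.
  by apply: (addIr (T 0)); rewrite add0r -E.
by rewrite -addrA !lT -[C c * z]addr0 lT T00' addr0 addrA.
Qed.

Let dg_coef m i n j c : C (block_coef q m i n j) * C (dg (m + n) (i + j) * c) = 0.
Proof.
rewrite -rmorphM /dg; case: (eqVneq (m + n) 0) => [mn|_]; last first.
  by rewrite !mul0r mulr0 rmorph0.
case: (eqVneq ((i + j)%N%:R) (- 2 * q)) => [ij|_]; last first.
  by rewrite mulr0 mul0r mulr0 rmorph0.
have -> : block_coef q m i n j = n%:~R * ((i + j)%N%:R + 2 * q).
  have -> : m = - n by apply/eqP; rewrite -addr_eq0 mn.
  by rewrite /block_coef rmorphN natrD /=; ring.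
by rewrite ij mulNr addNr mulr0 mul0r rmorph0.
Qed.

Let act_LL m i n j f :
  act (BL m i) (act (BL n j) f) - act (BL n j) (act (BL m i) f)
  = block_coef q m i n j *: act (BL (m + n) (i + j)) f.
Proof.
rewrite [RHS]scE !actLE.
rewrite !(lin3 _ _ _ _ _ _ (T0_lin _)).
rewrite !(lin3 _ _ _ _ _ _ (T1_lin _)).
rewrite [X in _ = X]mulrDr.
rewrite [X in _ = X + _]mulrDr.
rewrite [X in _ = _ + X + _]mulrA.
rewrite dg_coef mul0r.
have := T00 m n f; have := T11 m n f; have := @T01 m n f; have := @T01 n m f.
rewrite [n + m]addrC /dq /block_coef.
move: (T0 (m + n) f) (T1 (m + n) f) (T0 m (T0 n f)) (T0 n (T0 m f))
  (T1 m (T1 n f)) (T1 n (T1 m f)) (T1 m (T0 n f)) (T0 n (T1 m f))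
  (T0 m (T1 n f)) (T1 n (T0 m f)) => t0 t1 a a' b b' c c' d d'.
move: (T0 m f) (T0 n f) (T1 m f) (T1 n f) => m0 n0 m1 n1.
move: (dg m i * _) (dg n j * _) => g g' E1 E2 E3 E4.
move/eqP: E4; rewrite subr_eq => /eqP ->; move/eqP: E3; rewrite subr_eq => /eqP ->.
case: (eqVneq q (-1)) E1 E2 => [q1 /(_ q1)/eqP + /(_ q1)/eqP|_ _ _].
  rewrite !subr_eq => /eqP -> /eqP ->.
  by rewrite q1; case: i j => [|[|i]] [|[|j]]; rewrite /dn /=; ring.
by case: i j => [|[|i]] [|[|j]]; rewrite /dn /=; ring.
Qed.

Let act_LW m i n j f :
  act (BL m i) (act (BW n j) f) - act (BW n j) (act (BL m i) f)
  = block_coef q m i n j *: act (BW (m + n) (i + j)) f.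
Proof.
rewrite [RHS]scE !actLE !actWE.
rewrite !(lin3 _ _ _ _ _ _ (T0_lin _)) !(lin3 _ _ _ _ _ _ (T1_lin _)).
rewrite !(lin3 _ _ _ _ _ _ (U0_lin _)) !(lin3 _ _ _ _ _ _ (U1_lin _)).
rewrite [X in _ = X]mulrDr [X in _ = X + _]mulrDr [X in _ = _ + X + _]mulrA.
rewrite dg_coef mul0r.
have := TU00 m n f; have := TU11 m n f; have := @TU01 m n f.
have := @TU10 m n f; rewrite /dq /block_coef.
move: (U0 (m + n) f) (U1 (m + n) f) (T0 m (U0 n f)) (U0 n (T0 m f))
  (T1 m (U1 n f)) (U1 n (T1 m f)) (T1 m (U0 n f)) (U0 n (T1 m f))
  (T0 m (U1 n f)) (U1 n (T0 m f)) => t0 t1 a a' b b' c c' d d'.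
move: (T0 m f) (U0 n f) (T1 m f) (U1 n f) => m0 n0 m1 n1.
move: (dg m i * _) (dg n j * _) => g g' E1 E2 E3 E4.
move/eqP: E4; rewrite subr_eq => /eqP ->; move/eqP: E3; rewrite subr_eq => /eqP ->.
case: (eqVneq q (-1)) E1 E2 => [q1 /(_ q1)/eqP + /(_ q1)/eqP|_ _ _].
  rewrite !subr_eq => /eqP -> /eqP ->.
  by rewrite q1; case: i j => [|[|i]] [|[|j]]; rewrite /dn /=; ring.
by case: i j => [|[|i]] [|[|j]]; rewrite /dn /=; ring.
Qed.

Let act_WW m i n j f :
  act (BW m i) (act (BW n j) f) - act (BW n j) (act (BW m i) f) = 0.
Proof.
rewrite !actWE.
rewrite !(lin3 _ _ _ _ _ _ (U0_lin _)) !(lin3 _ _ _ _ _ _ (U1_lin _)).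
rewrite (U00 m n) (U11 m n) (U01 m n) -(U01 n m); ring.
Qed.

Lemma act_basis_linear b : linear (act b).
Proof.
have aux (T T' : A -> A) a d c : lin T -> lin T' ->
    linear (fun f => C a * T f + C d * f + C c * T' f).
  by move=> lT lT' k x y; rewrite !scE lT lT'; ring.
case: b => [m i|m i||] k x y.
- by rewrite !actLE aux.
- by rewrite !actWE aux.
- by rewrite /act scaler0 addr0.
- by rewrite /act scaler0 addr0.
Qed.

Lemma act_basis_bracket (a b : block_basis) (f : A) :
  act a (act b f) - act b (act a f)
  = block_bracket_basis q (fun c => act c f) a b.
Proof.
have act_linear := act_basis_linear.
have act0 c : act c 0 = 0.
  by have := act_linear c (-1) 0 0; rewrite scaler0 addr0 scaleN1r addNr.
have act1 x : act BC1 x = 0 by [].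
have act2 x : act BC2 x = 0 by [].
case: a b => [m i|m i||] [n j|n j||]; rewrite [RHS]/block_bracket_basis;
  try by rewrite !(act1, act2, act0) subrr.
- by rewrite act_LL act1 scaler0 addr0.
- by rewrite act_LW act2 scaler0 addr0.
- by rewrite -opprB act_LW act2 scaler0 addr0.
exact: act_WW.
Qed.
End OmegaRelations.


Section OmegaModule.
Variables (K : fieldType) (q lambda : nonzero K) (alpha : K).
Variables (beta gamma : K * K) (h : Tfamily alpha).
Local Notation Kts := {mpoly K[2]}.
Local Notation basis_act := (@omega_basis K q lambda alpha beta gamma h).

Let scE (c : K) (x : Kts) : c *: x = c%:MP * x.
Proof. by rewrite mul_mpolyC. Qed.

Lemma omega_basis_linear b : linear (basis_act b).
Proof.
exact: (@act_basis_linear K Kts (@mpolyC 2 K) (var_t K) (var_s K)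
  (@shift_s K) (@deriv_t K) (@poly_at K) scE (@shift_sD K) (@shift_sM K)
  (@shift_sC K) (@deriv_tD K) (@deriv_tM K) (@deriv_tC K) (@deriv_t_shift K)).
Qed.

Lemma omega_basis_bracket (a b : block_basis) (f : Kts) :
  basis_act a (basis_act b f) - basis_act b (basis_act a f)
  = block_bracket_basis (nzval q) (basis_act ^~ f) a b.
Proof.
refine (@act_basis_bracket K Kts (@mpolyC 2 K) (var_t K) (var_s K)
  (@shift_s K) (@deriv_t K) (@poly_at K) scE (@shift_sD K) (@shift_sM K)
  (@shift_sC K) (@shift_s_t K) (@shift_s_s K) (@shift_s_shift K)
  (@deriv_tD K) (@deriv_tM K) (@deriv_tC K) (@deriv_t_t K) (@deriv_t_s K)
  (@deriv_t_shift K) (@poly_atD K) (@poly_atM K) (@poly_atC K) (@poly_atX K)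
  (@poly_at_comp K) (@shift_s_poly_at K) (@deriv_t_poly_at K) q lambda alpha
  beta gamma h (nzvalP q) (nzvalP lambda) a b f).
Qed.

Definition omega_act (x : TakiffBlock (nzval q)) (f : Kts) : Kts :=
  linext (basis_act ^~ f) x.

Lemma omega_act_linearl f : linear (fun x => omega_act x f).
Proof. exact: linext_linear. Qed.

Lemma omega_act_linearr x : linear (omega_act x).
Proof. exact: linext_linear_comp omega_basis_linear. Qed.

Let linext_bracket f a b :
  linext (basis_act ^~ f) (block_bracket_basis (nzval q) (@evb K _) a b)
  = block_bracket_basis (nzval q) (basis_act ^~ f) a b.
Proof.
pose T : {linear free_module K block_basis -> Kts} :=
  HB.pack (linext (basis_act ^~ f)) (GRing.isLinear.Build K
    (free_module K block_basis) Kts _ _ (linext_linear (basis_act ^~ f))).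
have TE x : linext (basis_act ^~ f) x = T x by [].
have Te c : T (evb K c) = basis_act c f by rewrite -TE linext_evb.
rewrite TE; case: a b => [m i|m i||] [n j|n j||]; rewrite /block_bracket_basis.
all: by rewrite ?(linear0 T) ?(linearN T) ?(linearD T) ?(linearZZ T) ?Te.
Qed.

Lemma omega_act_bracket (x y : TakiffBlock (nzval q)) f :
  omega_act (lie_bracket x y) f
  = omega_act x (omega_act y f) - omega_act y (omega_act x f).
Proof.
have actr0 z : omega_act z 0 = 0.
  have := omega_act_linearr z (-1) 0 0.
  by rewrite scaler0 addr0 scaleN1r addNr.
have actl0 g : omega_act 0 g = 0.
  have := omega_act_linearl g (-1) 0 0.
  by rewrite scaler0 addr0 scaleN1r addNr.
have br_l0 z : block_bracket (nzval q) 0 z = 0.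
  have := block_bracket_linearl (nzval q) z (-1) 0 0.
  by rewrite scaler0 addr0 scaleN1r addNr.
have br_r0 z : block_bracket (nzval q) z 0 = 0.
  have := block_bracket_linearr (nzval q) z (-1) 0 0.
  by rewrite scaler0 addr0 scaleN1r addNr.
have acte b g : omega_act (evb K b) g = basis_act b g by exact: linext_evb.
have rearr (c : K) (a b r s : Kts) :
    c *: (a - b) + (r - s) = c *: a + r - (c *: b + s).
  by rewrite scalerBr opprD addrACA.
rewrite -[lie_bracket x y]/(block_bracket (nzval q) x y).
move: x y; apply: free_ind => [y|c a x IH y].
  by rewrite br_l0 !actl0 actr0 subrr.
rewrite block_bracket_linearl !omega_act_linearl omega_act_linearr -rearr IH.
congr (_ *: _ + _).
move: y {IH}; apply: free_ind => [|d b y IH].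
  by rewrite br_r0 !actl0 actr0 subrr.
rewrite block_bracket_linearr !omega_act_linearl omega_act_linearr -rearr IH.
congr (_ *: _ + _).
rewrite block_bracket_evb !acte omega_basis_bracket.
exact: linext_bracket.
Qed.

Definition Omega : lieModule (TakiffBlock (nzval q)) :=
  LieModule omega_act_linearl omega_act_linearr omega_act_bracket.
End OmegaModule.

(* Main.v *)
(* On Omega, W_{0,0} acts as multiplication by t and L_{0,0} as multiplication
   by s, so an isomorphism is multiplication by the image of 1, which must be an
   invertible polynomial, i.e. a nonzero scalar. Isomorphic modules therefore
   have the same action, and all the parameters can be read off the action on
   the constant polynomial 1. *)
Require Import Defs.
From HB Require Import structures.
From mathcomp Require Import all_boot all_order all_algebra.
From mathcomp Require Import boolp reals.
From mathcomp.real_closed Require Import complex.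
From mathcomp.multinomials Require Import mpoly.

Import GRing.Theory Num.Theory.
Local Open Scope ring_scope.
Local Open Scope complex_scope.

(** * Endomorphisms, units and specialisation of K[t, s] *)

Section TwoVariables.
Variable K : fieldType.
Local Notation Kts := {mpoly K[2]}.

(** Monomials span K[t, s], and each power of t or s can be pulled out of [f] one factor at a time,
    until only [f 1] is left. *)
Lemma linear_mul1 (f : Kts -> Kts) : linear f ->
  (forall p, f (var_t K * p) = var_t K * f p) ->
  (forall p, f (var_s K * p) = var_s K * f p) ->
  forall p, f p = p * f 1.
Proof.
move=> flin ft fs.
have f0 : f 0 = 0.
  by have := flin (-1) 0 0; rewrite scaler0 addr0 scaleN1r addNr.
elim/mpolyind => [|c m p _ _ IH]; first by rewrite f0 mul0r.
rewrite flin IH mulrDl -scalerAl; congr (_ *: _ + _).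
rewrite monomial_ts; elim: (m ord0) => [|k IHk].
  rewrite expr0 mul1r; elim: (m ord_max) => [|k IHk].
    by rewrite expr0 mul1r.
  by rewrite exprS -mulrA fs IHk mulrA.
by rewrite exprS -!mulrA ft mulrA IHk !mulrA.
Qed.

Lemma mpoly_unit_scalar (p r : Kts) : p * r = 1 ->
  exists2 c : K, c != 0 & p = c%:MP.
Proof.
rewrite mulrC => /mpoly_intro_unit/andP[/eqP pE]; rewrite unitfE => c0.
by exists p@_0.
Qed.

(** The specialisation s = 0. It turns identities in K[t, s] into identities in K[t], where
    coefficients can be compared. *)
Definition poly_of_t : Kts -> {poly K} :=
  mmap (@polyC K) (fun i : 'I_2 => if i == ord0 then 'X else 0).

Lemma poly_of_tD p r : poly_of_t (p + r) = poly_of_t p + poly_of_t r.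
Proof. exact: rmorphD. Qed.
Lemma poly_of_tN p : poly_of_t (- p) = - poly_of_t p.
Proof. exact: rmorphN. Qed.
Lemma poly_of_tM p r : poly_of_t (p * r) = poly_of_t p * poly_of_t r.
Proof. exact: rmorphM. Qed.
Lemma poly_of_tZ c p : poly_of_t (c *: p) = c *: poly_of_t p.
Proof. by rewrite [LHS]mmapZ mul_polyC. Qed.
Lemma poly_of_tC c : poly_of_t c%:MP = c%:P.
Proof. exact: mmapC. Qed.
Lemma poly_of_t_t : poly_of_t (var_t K) = 'X.
Proof. by rewrite [LHS]mmapX mmap1U. Qed.

Lemma poly_of_t_at p u : poly_of_t (poly_at p u) = p \Po poly_of_t u.
Proof.
elim/poly_ind: p => [|p c IH].
  by rewrite poly_at0 comp_poly0 -mpolyC0 poly_of_tC.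
rewrite poly_atD poly_atM poly_atC poly_atX poly_of_tD poly_of_tM IH poly_of_tC.
by rewrite comp_polyD comp_polyM comp_polyC comp_polyX.
Qed.

(** Serves, with c = q^-1, to recover h_m(t) from h_m(q^-1 t). *)
Lemma comp_poly_scaleX_inj (c : K) : c != 0 ->
  injective (fun p : {poly K} => p \Po (c *: 'X)).
Proof.
move=> c0; apply: (can_inj (g := fun p => p \Po (c^-1 *: 'X))) => p.
by rewrite -comp_polyA comp_polyZ comp_polyX scalerA mulfV // scale1r comp_polyXr.
Qed.

Lemma shift_s_by0 (f : Kts) : shift_s 0 f = f.
Proof.
elim/mpolyind: f => [|c m f _ _ IH]; first by rewrite shift_s0.
rewrite shift_sD shift_sZ IH monomial_ts shift_sM !shift_sXn shift_s_t shift_s_s.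
by rewrite mpolyC0 addr0.
Qed.

Lemma shift_s1 (c : K) : shift_s c 1 = 1.
Proof. by rewrite -mpolyC1 shift_sC. Qed.

Lemma deriv_t1 : deriv_t (1 : Kts) = 0.
Proof. by rewrite -mpolyC1 deriv_tC. Qed.
End TwoVariables.

(** * Reading the parameters off the action on 1 *)

Section Isomorphisms.
Variables (K : fieldType) (q : nonzero K).
Hypothesis two_neq0 : 2 != 0 :> K.

(** Removes the gamma terms from every generator of second index 0. *)
Let index0 : (0 == - 2 * nzval q) = false.
Proof.
by apply/negbTE; rewrite eq_sym mulf_neq0 ?oppr_eq0 ?two_neq0 ?nzvalP.
Qed.

Section Action.
Variables (lambda alpha : K) (beta gamma : K * K) (h : Tfamily alpha).
Local Notation act := (omega_basis q lambda beta gamma h).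
Let simpl0 := (index0, mulr0z, mulr0, mul0r, mul1r, mulr1, scale0r, scale1r,
  expr0z, addr0, add0r, subr0, oppr0, mpolyC0).

Lemma omega_W00 f : act (BW 0 0) f = var_t K * f.
Proof. by rewrite /= !simpl0 shift_s_by0. Qed.

(** Both coefficients m and m(m - 1) in the factored form of h_m vanish at m = 0. Hence L_{0,0} is
    exactly multiplication by s. *)
Lemma tfam0 : h 0 = 0.
Proof. by have [p [g [c _ ->]]] := tfam_factor h; rewrite !simpl0. Qed.

Lemma omega_L00 f : act (BL 0 0) f = var_s K * f.
Proof. by rewrite /= tfam0 poly_at0 !simpl0 scaler0 !simpl0 shift_s_by0. Qed.

Lemma omega_W1 m : act (BW m 0) 1
  = lambda ^ m *: (var_t K - (m%:~R * nzval q * alpha)%:MP).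
Proof. by rewrite /= !simpl0 shift_s1 !simpl0. Qed.

Lemma omega_L1 m : act (BL m 0) 1
  = lambda ^ m *: (var_s K + nzval q *: poly_at (h m) ((nzval q)^-1 *: var_t K)).
Proof.
by rewrite /= !simpl0 shift_s1 deriv_t1 !(simpl0, scaler0).
Qed.

Let index_neq0 k : k%:R = - 2 * nzval q -> (k == 0%N) = false.
Proof.
move=> kE; apply/negbTE; apply/negP => /eqP k0.
by move: index0; rewrite -kE k0 eqxx.
Qed.

(** For k = 1 and q = -1 the hypothesis would read 1 = 2. So the beta terms are absent at the index
    -2q. *)
Let index_qN1 k : k%:R = - 2 * nzval q ->
  (k == 1%N)%:R * (nzval q == -1)%:R = 0 :> K.
Proof.
move=> kE; case: eqP => [k1|]; last by rewrite mul0r.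
case: eqP => [q1|]; last by rewrite mulr0.
move/eqP: kE; rewrite k1 q1 mulrNN mulr1 -subr_eq0 -opprB oppr_eq0.
by rewrite -[2]natr1 addrK oner_eq0.
Qed.

Lemma omega_W0 k : k%:R = - 2 * nzval q -> act (BW 0 k) 1 = gamma.1 *: 1.
Proof.
by move=> kE; rewrite /= index_neq0 // index_qN1 // kE !eqxx !simpl0.
Qed.

Lemma omega_L0 k : k%:R = - 2 * nzval q -> act (BL 0 k) 1 = gamma.2 *: 1.
Proof.
by move=> kE; rewrite /= index_neq0 // index_qN1 // kE !eqxx !simpl0.
Qed.

(** For q = -1 the gamma terms sit at index 2, away from the beta terms at index 1. *)
Let one_index : nzval q = -1 -> (1 == - 2 * nzval q) = false.
Proof.
move=> ->; rewrite mulrNN mulr1 -subr_eq0 -opprB oppr_eq0.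
by rewrite -[2]natr1 addrK oner_eq0.
Qed.

Lemma omega_W01 : nzval q = -1 -> act (BW 0 1) 1 = beta.1 *: 1.
Proof. by move=> q1; rewrite /= one_index // q1 !eqxx !simpl0 shift_s1. Qed.

Lemma omega_L01 : nzval q = -1 -> act (BL 0 1) 1 = beta.2 *: 1.
Proof.
move=> q1; rewrite /= one_index // q1 !eqxx !simpl0 shift_s1 !simpl0.
by rewrite -mul_mpolyC mulr1.
Qed.
End Action.

(** * From an isomorphism to equal parameters *)

Section ParametersFromIso.
Variables (lambda lambda1 : nonzero K) (alpha alpha1 : K).
Variables (beta beta' gamma gamma' : K * K).
Variables (h : Tfamily alpha) (h1 : Tfamily alpha1).
Local Notation M := (Omega q lambda beta gamma h).
Local Notation N := (Omega q lambda1 beta' gamma' h1).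

Lemma omega_iso_eq : liemod_iso M N -> forall b f,
  omega_basis q lambda beta gamma h b f
  = omega_basis q lambda1 beta' gamma' h1 b f.
Proof.
case=> phi [psi phiK psiK] phi_act.
have phi_basis b f : phi (omega_basis q lambda beta gamma h b f)
    = omega_basis q lambda1 beta' gamma' h1 b (phi f).
  by have := phi_act (evb K b) f; rewrite /= /omega_act !linext_evb.
have phi_mul1 : forall p, phi p = p * phi 1.
  apply: linear_mul1 => [|p|p]; first exact: linearP.
    by rewrite -(omega_W00 lambda alpha beta gamma h) phi_basis omega_W00.
  by rewrite -(omega_L00 lambda alpha beta gamma h) phi_basis omega_L00.
have [c c0 phi1] : exists2 c : K, c != 0 & phi 1 = c%:MP.
  (* The inverse of [phi 1] is [psi 1], since 1 = phi (psi 1) = psi 1 * phi 1. *)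
  by apply: (@mpoly_unit_scalar _ _ (psi 1)); rewrite mulrC -phi_mul1 psiK.
have phiE p : phi p = c *: p by rewrite phi_mul1 phi1 mulrC mul_mpolyC.
have basisZ b f : omega_basis q lambda1 beta' gamma' h1 b (c *: f)
    = c *: omega_basis q lambda1 beta' gamma' h1 b f.
  have lin := @omega_basis_linear _ q lambda1 _ beta' gamma' h1 b.
  have b0 := lin (-1) 0 0; rewrite scaler0 addr0 scaleN1r addNr in b0.
  by have := lin c f 0; rewrite b0 !addr0.
move=> b f; apply: (scalerI c0).
by rewrite -phiE phi_basis phiE basisZ.
Qed.

(** The action shows gamma only when -2q is a natural number and beta only when q = -1, hence the
    two conditional conclusions. *)
Lemma omega_iso_params : liemod_iso M N ->
  [/\ [/\ nzval lambda = nzval lambda1, alpha = alpha1 & tfam h = tfam h1],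
      (exists k : nat, k%:R = - 2 * nzval q) -> gamma = gamma'
    & nzval q = -1 -> beta = beta'].
Proof.
move=> /omega_iso_eq eq_act.
have scal1 (a b : K) : a *: 1 = b *: 1 :> {mpoly K[2]} -> a = b.
  move/(congr1 (@poly_of_t K)); rewrite !poly_of_tZ -mpolyC1 poly_of_tC.
  by rewrite -!mul_polyC !mulr1 => /polyC_inj.
have := eq_act (BW 1 0) 1; rewrite !omega_W1 !expr1z !mul1r.
(* W_{1,0} sends 1 to lambda (t - q alpha): the coefficient of t gives lambda, then the constant
   term gives alpha because lambda and q are nonzero. *)
move/(congr1 (@poly_of_t K)).
rewrite !poly_of_tZ !poly_of_tD !poly_of_tN !poly_of_tC !poly_of_t_t => E.
have lamE : nzval lambda = nzval lambda1.
  have := congr1 (fun p : {poly K} => p`_1) E.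
  by rewrite !coefZ !coefB !coefX !coefC /= !subr0 !mulr1.
have alphaE : alpha = alpha1.
  have := congr1 (fun p : {poly K} => p`_0) E.
  rewrite lamE !coefZ !coefB !coefX !coefC /= !sub0r.
  by move/(mulfI (nzvalP lambda1))/oppr_inj/(mulfI (nzvalP q)).
have hE : tfam h = tfam h1.
  (* L_{m,0} sends 1 to lambda^m (s + q h_m(q^-1 t)); the factor lambda^m, the summand s and the
     factor q cancel in turn. *)
  apply: funext => m; have := eq_act (BL m 0) 1; rewrite !omega_L1 lamE.
  move/scalerI => /(_ (expfz_neq0 _ (nzvalP lambda1)))/addrI.
  move/scalerI => /(_ (nzvalP q))/(congr1 (@poly_of_t K)).
  rewrite !poly_of_t_at !poly_of_tZ poly_of_t_t.
  by apply: comp_poly_scaleX_inj; rewrite invr_neq0 ?nzvalP.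
split=> // [[k kE]|q1].
  have := eq_act (BW 0 k) 1; have := eq_act (BL 0 k) 1.
  rewrite !omega_L0 // !omega_W0 // => /scal1 g2 /scal1 g1.
  by rewrite [LHS]surjective_pairing g1 g2 -surjective_pairing.
have := eq_act (BW 0 1) 1; have := eq_act (BL 0 1) 1.
rewrite !omega_L01 // !omega_W01 // => /scal1 b2 /scal1 b1.
by rewrite [LHS]surjective_pairing b1 b2 -surjective_pairing.
Qed.
End ParametersFromIso.

(** The identity of K[t, s] is the isomorphism: the action depends on the records only through their
    underlying values. *)
Lemma omega_iso_of_eq (lambda lambda1 : nonzero K) (alpha alpha1 : K)
    (beta gamma : K * K) (h : Tfamily alpha) (h1 : Tfamily alpha1) :
  nzval lambda = nzval lambda1 -> alpha = alpha1 -> tfam h = tfam h1 ->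
  liemod_iso (Omega q lambda beta gamma h) (Omega q lambda1 beta gamma h1).
Proof.
(* The type of [h1] depends on [alpha1], so [h1] is generalised before [alpha1] is replaced. *)
move=> lamE alphaE; move: h1; rewrite -alphaE => h1 hE {alphaE alpha1}.
have actE b f : omega_basis q lambda beta gamma h b f
    = omega_basis q lambda1 beta gamma h1 b f.
  by case: b => [m i|m i||] //=; rewrite ?/Theta lamE ?hE.
pose phi : {linear Omega q lambda beta gamma h
    -> Omega q lambda1 beta gamma h1} :=
  HB.pack (fun p : {mpoly K[2]} => p) (GRing.isLinear.Build K
    (Omega q lambda beta gamma h) (Omega q lambda1 beta gamma h1) _
    (fun p : {mpoly K[2]} => p) (fun c p r => erefl)).
exists phi; first by exists id.
move=> x p; rewrite /= /omega_act /linext; apply: eq_bigr => b _.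
by rewrite actE.
Qed.
End Isomorphisms.

Theorem theorem3p4 (R : realType) (q lambda lambda1 : nonzero R[i])
    (alpha alpha1 : R[i]) (beta beta' gamma gamma' : R[i] * R[i])
    (h : Tfamily alpha) (h1 : Tfamily alpha1) :
  [/\ ~ (exists k : nat, k%:R = - 2 * nzval q) ->
       (liemod_iso (Omega q lambda (0, 0) (0, 0) h)
                   (Omega q lambda1 (0, 0) (0, 0) h1)
        <-> [/\ nzval lambda = nzval lambda1, alpha = alpha1
              & tfam h = tfam h1]),
      (exists k : nat, k%:R = - 2 * nzval q) -> nzval q <> - 1 ->
       (liemod_iso (Omega q lambda (0, 0) gamma h)
                   (Omega q lambda1 (0, 0) gamma' h1)
        <-> [/\ nzval lambda = nzval lambda1, alpha = alpha1, gamma = gamma'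
              & tfam h = tfam h1])
    & nzval q = - 1 ->
       (liemod_iso (Omega q lambda beta gamma h)
                   (Omega q lambda1 beta' gamma' h1)
        <-> [/\ nzval lambda = nzval lambda1, alpha = alpha1, beta = beta'
              & gamma = gamma' /\ tfam h = tfam h1])].
Proof.
have two_neq0 : 2 != 0 :> R[i] by rewrite pnatr_eq0.
split=> [_|ex qN1|q1].
- split=> [/(omega_iso_params _ _ two_neq0)[]//|[lamE alphaE hE]].
  exact: omega_iso_of_eq.
- split=> [/(omega_iso_params _ _ two_neq0)[[? ? ?] /(_ ex) ? _]//|].
  by case=> lamE alphaE <- hE; apply: omega_iso_of_eq.
have ex : exists k : nat, k%:R = - 2 * nzval q.
  (* For q = -1 the index -2q is 2, so gamma is also determined in this case. *)
  by exists 2%N; rewrite q1 mulrNN mulr1.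
split=> [/(omega_iso_params _ _ two_neq0)[[? ? ?] /(_ ex) ? /(_ q1) ?]//|].
by case=> lamE alphaE <- [<- hE]; apply: omega_iso_of_eq.
Qed.
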